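(* There exists an absolute constant $C > 0$ such that the following holds. Let $A \in \mathbb{C}^{m \times n}$, $\varepsilon \in (0,1)$ and $\delta \in (0,1/2)$, and let $R \in \mathbb{R}^{n \times d}$ be an SJLT with $\alpha$ nonzero entries per row, constructed using either the graph construction or the block construction. If $d \geq C \varepsilon^{-2} \log(1/\delta)$ and $\alpha = \lceil \varepsilon d \rceil$, then with probability at least $1-\delta$: $$(1-\varepsilon) \| A \|_F^2 \leq \| A R \|_F^2 \leq (1+\varepsilon)\| A \|_F^2 .$$
   Context: $\|\cdot\|_F$ is the Frobenius norm and $\log$ is the natural logarithm. Sparse Johnson--Lindenstrauss transform (SJLT): for integers $n$, $d$ and $\alpha \in \{1,\dots,d\}$, an SJLT matrix $R \in \mathbb{R}^{n\times d}$ is a random matrix with exactly $\alpha$ nonzero entries in each row. The nonzero entries are independent and uniform on $\{1/\sqrt{\alpha}, -1/\sqrt{\alpha}\}$, and are independent of the positions of the nonzeros. The positions of the nonzeros are drawn independently for different rows, by one of two methods. Graph construction: for each row, the set of $\alpha$ nonzero positions is a uniformly random $\alpha$-element subset of $\{1,\dots,d\}$. Block construction (requires $d/\alpha$ to be an integer): each length-$d$ row is divided into $\alpha$ contiguous chunks of length $d/\alpha$, and in each chunk exactly one position, chosen uniformly at random (independently over chunks), is nonzero. *)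

(* Defs.v *)
From HB Require Import structures.
From mathcomp Require Import all_boot all_order all_algebra.
From mathcomp Require Import all_classical all_reals all_analysis.
From mathcomp.real_closed Require Import complex.

Set Implicit Arguments.
Unset Strict Implicit.
Unset Printing Implicit Defensive.

Import Order.TTheory GRing.Theory Num.Theory.
Import numFieldNormedType.Exports.

Local Open Scope classical_set_scope.
Local Open Scope ring_scope.

(* [normc] is the modulus as an element of [K]; the generic norm [`|z|] of
   [K[i]] lives in [K[i]]. *)
Definition frob (K : realType) (m n : nat) (A : 'M[K[i]]_(m, n)) : K :=
  Num.sqrt (\sum_(i < m) \sum_(j < n) ComplexField.Normc.normc (A i j) ^+ 2).

Definition complex_mx (K : realType) (m n : nat) (A : 'M[K]_(m, n)) :
  'M[K[i]]_(m, n) := map_mx (real_complex K) A.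

(* All random variables below take finitely many values almost surely, so
   independence and uniformity are expressed through point probabilities. *)
Section discrete_random_variables.
Context (K : realType) (disp : measure_display) (T : measurableType disp).
Variable P : probability T K.
Local Open Scope ereal_scope.

Definition mutually_independent (I : finType) (E : Type) (X : I -> T -> E) :=
  forall (J : {set I}) (x : I -> E),
    P [set w | forall i, i \in J -> X i w = x i] =
    \prod_(i in J) P [set w | X i w = x i].

Definition independent_pair (E F : Type) (X : T -> E) (Y : T -> F) :=
  forall x y, P [set w | X w = x /\ Y w = y] =
              P [set w | X w = x] * P [set w | Y w = y].

(* [s] must be nonempty and duplicate-free. *)
Definition uniform_on (E : eqType) (s : seq E) (X : T -> E) :=
  forall x, P [set w | X w = x] = ((x \in s)%:R / (size s)%:R)%:E.

End discrete_random_variables.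

Section sjlt.
Context (K : realType) (n d : nat).

Definition nonzero_pos (M : 'M[K]_(n, d)) (i : 'I_n) : {set 'I_d} :=
  [set j | M i j != 0]%SET.

(* The nonzero entries of each row, listed from left to right. The default
   value 0 of sequence indexing appears only in a row with fewer than [alpha]
   nonzero entries. *)
Definition nonzero_entries (alpha : nat) (M : 'M[K]_(n, d)) :
    'M[K]_(n, alpha) :=
  \matrix_(i < n, k < alpha) [seq M i j | j <- enum 'I_d & M i j != 0]`_k.

Definition chunk (alpha : nat) (c : 'I_alpha) : {set 'I_d} :=
  [set j : 'I_d | (j %/ (d %/ alpha) == c)%N]%SET.

Context (disp : measure_display) (T : measurableType disp).
Variables (P : probability T K) (alpha : nat) (R : T -> 'M[K]_(n, d)).

Definition sjlt_base : Prop :=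
  [/\ (0 < alpha <= d)%N,
      forall i j, measurable_fun setT (fun w => R w i j),
      {ae P, forall w, forall i, #|nonzero_pos (R w) i| = alpha}
    & [/\ mutually_independent P (fun (ik : 'I_n * 'I_alpha) w =>
            nonzero_entries alpha (R w) ik.1 ik.2),
          forall i k, uniform_on P
            [:: 1 / Num.sqrt alpha%:R; - (1 / Num.sqrt alpha%:R)]
            (fun w => nonzero_entries alpha (R w) i k),
          independent_pair P
            (fun w => nonzero_entries alpha (R w))
            (fun w => [ffun i => nonzero_pos (R w) i])
        & mutually_independent P (fun i w => nonzero_pos (R w) i)]].

Definition graph_sjlt : Prop :=
  sjlt_base /\
  forall i, uniform_on P (enum [set S : {set 'I_d} | #|S| == alpha]%SET)
                         (fun w => nonzero_pos (R w) i).

Definition block_sjlt : Prop :=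
  [/\ sjlt_base,
      (alpha %| d)%N
    & forall i,
        mutually_independent P
          (fun (c : 'I_alpha) w => (nonzero_pos (R w) i :&: chunk c)%SET) /\
        forall c : 'I_alpha,
          uniform_on P [seq [set j]%SET | j <- enum (chunk c)]
            (fun w => (nonzero_pos (R w) i :&: chunk c)%SET)].

End sjlt.

(* Main.v *)
Require Import Defs.
From mathcomp Require Import all_boot all_order all_algebra.
From mathcomp Require Import all_classical all_reals all_analysis measurable_realfun.
From mathcomp.real_closed Require Import complex.
From mathcomp Require Import zify ring lra.

Set Implicit Arguments.
Unset Strict Implicit.
Unset Printing Implicit Defensive.

Import Order.TTheory GRing.Theory Num.Theory.
Import numFieldNormedType.Exports.

Local Open Scope classical_set_scope.
Local Open Scope ring_scope.

(* Writing the rows of [R] as signs on random positions, [||AR||^2 - ||A||^2] is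
   [1 / alpha] times the sum, over the real and imaginary parts [x] of the rows
   of [A], of the off-diagonal Rademacher chaoses
   [\sum_r (Z_r ^+ 2 - V_r)], where [Z_r] is the signed sum of the [x_i]
   landing in column [r] and [V_r] is the sum of their squares.

   For fixed positions the exponential moment of a chaos is bounded by removing
   the signs one at a time; the result is the exponential of a multiple of
   [\sum_(i != i') x_i^2 x_i'^2 |S_i :&: S_i'|].  By convexity the average over
   the positions reduces to the exponential moment of a single [|S_a :&: S_b|],
   which expands as [\sum_B q^|B| P(B <= S_a) P(B <= S_b)], and both
   constructions satisfy [P(B <= S) <= (alpha / d)^|B|].  A further convexity
   argument combines the rows of [A], and Markov's inequality concludes. *)

(** * Elementary inequalities for the exponential *)

Lemma cosh_le_expR (K : realType) (x : K) :
  (expR x + expR (- x)) / 2 <= expR (2 * x ^+ 2).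
Proof.
have exp_abs (y : K) : expR y <= expR `|y| by rewrite ler_expR ler_norm.
(* For [|x| >= 1/2], both exponentials are at most [exp |x|], and [|x| <= 2 x^2]. For [|x| < 1/2],
   [exp y <= 1 / (1 - y)] bounds the average by [1 / (1 - x^2)], which is at most [1 + 2 x^2]. *)
have [small|large] := ltP `|x| (1 / 2); last first.
  have h1 := exp_abs x; have h2 := exp_abs (- x); rewrite normrN in h2.
  have h3 : expR `|x| <= expR (2 * x ^+ 2).
    by rewrite ler_expR -real_normK ?num_real//; nra.
  by lra.
have inv_bound (y : K) : `|y| < 1 / 2 -> expR y * (1 - y) <= 1.
  move=> yh; have := expR_ge1Dx (- y); rewrite expRN => h.
  have e0 := expR_gt0 y.
  have : expR y * (1 + - y) <= expR y * (expR y)^-1 by rewrite ler_pM2l.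
  by rewrite divff ?gt_eqF.
have h1 := inv_bound x small.
have := inv_bound (- x); rewrite normrN opprK => /(_ small) h2.
have h3 := expR_ge1Dx (2 * x ^+ 2).
move: small; rewrite ltr_norml => /andP[xl xr].
have e1 := expR_gt0 x; have e2 := expR_gt0 (- x).
suff : (expR x + expR (- x)) / 2 * (1 - x ^+ 2) <= (1 + 2 * x ^+ 2) * (1 - x ^+ 2).
  rewrite ler_pM2r; last by nra.
  by move=> h; apply: le_trans h _.
have -> : (expR x + expR (- x)) / 2 * (1 - x ^+ 2) =
   (expR x * (1 - x) * (1 + x) + expR (- x) * (1 + x) * (1 - x)) / 2 by field.
have : expR x * (1 - x) * (1 + x) <= 1 * (1 + x) by rewrite ler_pM2r; lra.
have : expR (- x) * (1 + x) * (1 - x) <= 1 * (1 - x) by rewrite ler_pM2r; lra.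
have : 1 <= (1 + 2 * x ^+ 2) * (1 - x ^+ 2).
  have : 0 <= x ^+ 2 * (1 - 2 * x ^+ 2) by rewrite mulr_ge0 ?sqr_ge0//; nra.
  by lra.
lra.
Qed.

(** Jensen's inequality: the convex function lies above its tangent at the mean [m], and averaging
    the tangent gives [expR m]. *)
Lemma expR_sum_le (K : realType) (I : finType) (w u : I -> K) :
  (forall i, 0 <= w i) -> \sum_i w i = 1 ->
  expR (\sum_i w i * u i) <= \sum_i w i * expR (u i).
Proof.
move=> w0 w1; set m := \sum_i w i * u i.
suff : \sum_i w i * (expR m * (1 + (u i - m))) <= \sum_i w i * expR (u i).
  apply: le_trans.
  have -> : \sum_i w i * (expR m * (1 + (u i - m))) =
     expR m * ((1 - m) * \sum_i w i + m).
    rewrite mulr_sumr /m -big_split /= mulr_sumr; apply: eq_bigr => i _; ring.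
  by rewrite w1 mulr1 subrK mulr1.
apply: ler_sum => i _; apply: ler_wpM2l => //.
by rewrite -[X in _ <= expR X](subrKC m) expRD ler_pM2l ?expR_gt0 ?expR_ge1Dx.
Qed.

(** * Exponential moment of an off-diagonal Rademacher chaos with fixed positions *)

Section chaos.
Context (K : realType) (E D : finType) (col : E -> D) (v : E -> K).
Implicit Types (s : seq E) (sg : {ffun E -> bool}) (t : D -> K).

Definition sgn (b : bool) : K := if b then 1 else -1.
Definition flip e sg : {ffun E -> bool} := [ffun e' => (e' == e) (+) sg e'].
Definition colsum s sg r := \sum_(e <- s | col e == r) sgn (sg e) * v e.
Definition colmass s r := \sum_(e <- s | col e == r) v e ^+ 2.

Lemma flipK e : involutive (flip e).
Proof. by move=> sg; apply/ffunP => e'; rewrite !ffunE addbA addbb. Qed.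

Lemma flip_sum e (F : {ffun E -> bool} -> K) :
  \sum_sg F sg = \sum_sg (F sg + F (flip e sg)) / 2.
Proof.
rewrite -mulr_suml big_split /=.
rewrite [X in _ + X](_ : _ = \sum_sg F sg); first by field.
by rewrite [RHS](reindex_inj (inv_inj (flipK e))).
Qed.

Lemma colmass_ge0 s r : 0 <= colmass s r.
Proof. by apply: sumr_ge0 => e _; exact: sqr_ge0. Qed.

(* Averaging over the sign of an index [e] in column [c] replaces [t c] by
   [t c + 8 * t c ^+ 2 * v e ^+ 2], since [cosh y <= exp (2 y^2)]; the hypothesis
   on [tau] is preserved by this step, and keeps all coefficients below [tau]. *)
Lemma chaos_mgf s (tau : K) t : 0 <= tau -> uniq s ->
  (forall r, `|t r| * (1 + 8 * tau * colmass s r) <= tau) ->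
  \sum_sg expR (\sum_r t r * (colsum s sg r ^+ 2 - colmass s r)) <=
  #|{ffun E -> bool}|%:R *
    expR (4 * tau ^+ 2 * (\sum_r colmass s r ^+ 2 - \sum_(e <- s) v e ^+ 4)).
Proof.
move=> tau0; elim: s t => [|e s IH] t /= => [_ _|/andP[es us] ht].
  rewrite (eq_bigr (fun=> 1)) => [|sg _]; last first.
    by rewrite big1 ?expR0 // => r _; rewrite /colsum /colmass !big_nil expr0n subrr mulr0.
  have -> : \sum_r colmass [::] r ^+ 2 = 0.
    by apply: big1 => r _; rewrite /colmass big_nil expr0n.
  by rewrite big_nil subr0 mulr0 expR0 mulr1 sumr_const.
have massE r : colmass (e :: s) r = (if col e == r then v e ^+ 2 else 0) + colmass s r.
  by rewrite /colmass big_cons; case: ifP; rewrite ?add0r.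
have sumE sg r : colsum (e :: s) sg r = (if col e == r then sgn (sg e) * v e else 0) + colsum s sg r.
  by rewrite /colsum big_cons; case: ifP; rewrite ?add0r.
have sum_flip sg r : colsum s (flip e sg) r = colsum s sg r.
  rewrite /colsum !(big_seq_cond (fun e => col e == r)).
  apply: eq_bigr => e' /andP[e's _].
  by rewrite ffunE (negbTE (memPn es _ e's)).
set c := col e; set t' := fun r => if c == r then t r + 8 * t r ^+ 2 * v e ^+ 2 else t r.
have t_tau r : `|t r| <= tau.
  apply: le_trans (ht r); rewrite ler_peMr // lerDl.
  by rewrite !mulr_ge0 // colmass_ge0.
have step sg : (expR (\sum_r t r * (colsum (e :: s) sg r ^+ 2 - colmass (e :: s) r)) +
    expR (\sum_r t r * (colsum (e :: s) (flip e sg) r ^+ 2 - colmass (e :: s) r))) / 2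
  <= expR (\sum_r t' r * (colsum s sg r ^+ 2 - colmass s r)) *
     expR (8 * tau ^+ 2 * v e ^+ 2 * colmass s c).
  (* In column [c] the square of the new term cancels against its mass, so only the cross term [x]
     remains, and flipping the sign of [e] turns it into [-x]. *)
  set Z := colsum s sg c; set x := 2 * t c * (sgn (sg e) * v e) * Z.
  set B := \sum_r t r * (colsum s sg r ^+ 2 - colmass s r).
  have sgn2 b : sgn b ^+ 2 = 1 by rewrite /sgn; case: b; rewrite ?sqrrN expr1n.
  have sgnN b : sgn (~~ b) = - sgn b by case: b; rewrite /sgn ?opprK.
  have E1 : \sum_r t r * (colsum (e :: s) sg r ^+ 2 - colmass (e :: s) r) = B + x.
    rewrite /B (bigD1 c) //= [in RHS](bigD1 c) //= massE sumE eqxx -/Z.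
    rewrite (eq_bigr (fun r => t r * (colsum s sg r ^+ 2 - colmass s r))) => [|r rc]; last first.
      by rewrite massE sumE eq_sym (negbTE rc) !add0r.
    rewrite /x; have := sgn2 (sg e); move: (sgn _) => a a2.
    have -> : (a * v e + Z) ^+ 2 = a ^+ 2 * v e ^+ 2 + 2 * a * v e * Z + Z ^+ 2 by ring.
    by rewrite a2; ring.
  have E2 : \sum_r t r * (colsum (e :: s) (flip e sg) r ^+ 2 - colmass (e :: s) r) = B - x.
    rewrite /B (bigD1 c) //= [in RHS](bigD1 c) //= massE sumE eqxx sum_flip -/Z.
    rewrite (eq_bigr (fun r => t r * (colsum s sg r ^+ 2 - colmass s r))) => [|r rc]; last first.
      by rewrite massE sumE sum_flip eq_sym (negbTE rc) !add0r.
    rewrite ffunE eqxx addTb sgnN /x; have := sgn2 (sg e); move: (sgn _) => a a2.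
    have -> : (- a * v e + Z) ^+ 2 = a ^+ 2 * v e ^+ 2 - 2 * a * v e * Z + Z ^+ 2 by ring.
    by rewrite a2; ring.
  rewrite E1 E2.
  have -> : (expR (B + x) + expR (B - x)) / 2 = expR B * ((expR x + expR (- x)) / 2).
    by rewrite !expRD; ring.
  apply: le_trans (ler_wpM2l (expR_ge0 _) (cosh_le_expR x)) _.
  rewrite -!expRD ler_expR.
  have -> : \sum_r t' r * (colsum s sg r ^+ 2 - colmass s r) =
     B + 8 * t c ^+ 2 * v e ^+ 2 * (Z ^+ 2 - colmass s c).
    rewrite /B (bigD1 c) //= [in RHS](bigD1 c) //= /t' eqxx -/Z.
    rewrite (eq_bigr (fun r => t r * (colsum s sg r ^+ 2 - colmass s r))) => [|r rc]; last first.
      by rewrite eq_sym (negbTE rc).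
    ring.
  have -> : 2 * x ^+ 2 = 8 * t c ^+ 2 * v e ^+ 2 * Z ^+ 2.
    rewrite /x; have := sgn2 (sg e); move: (sgn _) => a a2.
    have -> : 2 * (2 * t c * (a * v e) * Z) ^+ 2 = a ^+ 2 * (8 * t c ^+ 2 * v e ^+ 2 * Z ^+ 2) by ring.
    by rewrite a2 mul1r.
  (* [2 x^2] contributes [Z^2], while [t'] carries the centred [Z^2 - colmass s c]; the difference
     is deterministic and leaves the sum as a constant factor. *)
  have : t c ^+ 2 * (v e ^+ 2 * colmass s c) <= tau ^+ 2 * (v e ^+ 2 * colmass s c).
    apply: ler_wpM2r; first by rewrite mulr_ge0 ?sqr_ge0 ?colmass_ge0.
    by rewrite -(real_normK (num_real (t c))) ler_sqr ?nnegrE.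
  lra.
rewrite (flip_sum e); apply: le_trans (ler_sum _ (fun sg _ => step sg)) _.
rewrite -mulr_suml.
(* The coefficient grows by a factor at most [1 + 8 |t c| v_e^2], which is paid for by removing
   [v_e^2] from the mass of column [c]. *)
have ht' r : `|t' r| * (1 + 8 * tau * colmass s r) <= tau.
  have m0 := colmass_ge0 s r; have := ht r; rewrite massE /t' -/c.
  case: eqP => _; last by rewrite add0r.
  move=> ht0; apply: (le_trans _ ht0).
  have v0 := sqr_ge0 (v e).
  have : `|t r + 8 * t r ^+ 2 * v e ^+ 2| <= `|t r| * (1 + 8 * `|t r| * v e ^+ 2).
    apply: le_trans (ler_normD _ _) _.
    have -> : `|8 * t r ^+ 2 * v e ^+ 2| = 8 * `|t r| ^+ 2 * v e ^+ 2.
      rewrite real_normK ?num_real // ger0_norm //.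
      by rewrite -mulrA mulr_ge0 // mulr_ge0 // sqr_ge0.
    lra.
  move=> h; apply: le_trans (ler_wpM2r _ h) _; first by rewrite addr_ge0 // !mulr_ge0.
  rewrite -[leLHS]mulrA; apply: ler_wpM2l => //.
  suff : `|t r| * (1 + 8 * tau * colmass s r) * v e ^+ 2 <= tau * v e ^+ 2 by lra.
  rewrite ler_wpM2r //; apply: le_trans (ht r); rewrite ler_wpM2l // lerD2l.
  rewrite ler_wpM2l ?mulr_ge0 // massE; case: ifP => _; last by rewrite add0r.
  by rewrite lerDr.
apply: le_trans (ler_wpM2r (expR_ge0 _) (IH t' us ht')) _.
rewrite -[leLHS]mulrA -expRD ler_wpM2l // ler_expR big_cons.
(* With [m = colmass s c], adding [e] raises the exponent by [4 tau^2 ((v_e^2 + m)^2 - m^2 - v_e^4)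
   = 8 tau^2 v_e^2 m], exactly the constant produced by [step]. *)
rewrite (bigD1 c) //= [X in _ <= _ * (X - _)](bigD1 c) //= massE eqxx.
rewrite [X in _ <= _ * (_ + X - _)](eq_bigr (fun r => colmass s r ^+ 2)) => [|r rc]; last first.
  by rewrite massE eq_sym (negbTE rc) add0r.
lra.
Qed.
End chaos.

(** * Exponential moments of the overlaps between independent random supports *)

Lemma sum_subset_expr (K : realType) (D : finType) (q : K) (A : {set D}) :
  \sum_(B : {set D}) q ^+ #|B| * (B \subset A)%:R = (1 + q) ^+ #|A|.
Proof.
(* Expanding this product over all of [D] chooses, for each subset [B], the factors [q * (r \in A)]
   with [r] in [B]. *)
have -> : (1 + q) ^+ #|A| = \prod_r (q * (r \in A)%:R + 1).
  rewrite -prodr_const big_mkcond /=; apply: eq_bigr => r _.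
  by case: (r \in A); rewrite ?mulr1 ?mulr0 ?add0r // addrC.
rewrite bigA_distr; apply: eq_bigr => B _.
rewrite -big_mkcond /= big_split /= prodr_const; congr (_ * _).
have [/fintype.subsetP BA|/fintype.subsetPn[r rB rA]] := boolP (B \subset A).
  by rewrite big1 // => r /BA ->.
by rewrite (bigD1 r) //= (negbTE rA) mul0r.
Qed.

Section pattern.
Context (K : realType) (I D : finType) (mu : I -> {set D} -> K) (p : K).
Hypothesis mu_ge0 : forall i S, 0 <= mu i S.
Hypothesis mu_sum1 : forall i, \sum_S mu i S = 1.
Hypothesis mu_superset : forall i (B : {set D}),
  \sum_S mu i S * (B \subset S)%:R <= p ^+ #|B|.

(** Expand [(1 + q)^|S_i :&: S_i'|] over the subsets [B] of the intersection. As [i != i'], the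
    weight of [B] factorizes into two superset probabilities, each at most [p^|B|]; summing
    [(q p^2)^|B|] over all [B] gives the bound. *)
Lemma intersection_mgf i i' (q : K) : i != i' -> 0 <= q ->
  \sum_(S : {ffun I -> {set D}})
     (\prod_l mu l (S l)) * (1 + q) ^+ #|S i :&: S i'|%SET
  <= (1 + q * p ^+ 2) ^+ #|D|.
Proof.
move=> ii' q0.
rewrite -cardsT -sum_subset_expr.
under eq_bigr => S _ do rewrite -sum_subset_expr mulr_sumr.
rewrite exchange_big /=; apply: ler_sum => B _.
rewrite finset.subsetT mulr1 exprMn.
(* Writing the event as a product over all rows lets the sum over patterns distribute into a product
   of one-row sums. *)
pose f l (T : {set D}) : K := if (l == i) || (l == i') then (B \subset T)%:R else 1.
have -> : \sum_(S : {ffun I -> {set D}}) (\prod_l mu l (S l)) *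
     (q ^+ #|B| * (B \subset (S i :&: S i'))%:R) =
   q ^+ #|B| * \prod_l \sum_T mu l T * f l T.
  rewrite bigA_distr_bigA /= mulr_sumr; apply: eq_bigr => S _.
  rewrite mulrCA big_split /=; congr (_ * (_ * _)).
  rewrite (bigD1 i) //= (bigD1 i') /=; last by rewrite eq_sym.
  rewrite big1 ?mulr1 => [|l /andP[li li']]; last first.
    by rewrite /f (negbTE li) (negbTE li').
  by rewrite /f !eqxx orbT finset.subsetI -natrM mulnb.
apply: ler_wpM2l; first exact: exprn_ge0.
rewrite (bigD1 i) //= (bigD1 i') /=; last by rewrite eq_sym.
rewrite [X in _ * (_ * X)]big1 ?mulr1 => [|l /andP[li li']]; last first.
  by rewrite /f (negbTE li) (negbTE li'); under eq_bigr do rewrite mulr1.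
rewrite /f !eqxx orbT -exprM mulnC exprM expr2.
by apply: ler_pM => /=; [apply: sumr_ge0 => T _; rewrite mulr_ge0|apply: sumr_ge0 => T _; rewrite mulr_ge0|exact: mu_superset|exact: mu_superset].
Qed.

(** The weights [x_i^2 x_i'^2] over all pairs sum to 1, so Jensen's inequality reduces the claim to
    one pair. Diagonal pairs keep their weight but get exponent 0; they contribute 1, which is below
    the bound. *)
Lemma pattern_mgf (x : I -> K) (c : K) : 0 <= c -> \sum_i x i ^+ 2 = 1 ->
  \sum_(S : {ffun I -> {set D}}) (\prod_l mu l (S l)) *
     expR (c * \sum_i \sum_(i' | i' != i) x i ^+ 2 * x i' ^+ 2 * #|S i :&: S i'|%SET%:R)
  <= (1 + (expR c - 1) * p ^+ 2) ^+ #|D|.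
Proof.
move=> c0 x1; set q := expR c - 1.
have q0 : 0 <= q by rewrite subr_ge0 -expR0 ler_expR.
pose w (ii : I * I) := x ii.1 ^+ 2 * x ii.2 ^+ 2.
have w0 ii : 0 <= w ii by rewrite mulr_ge0 ?sqr_ge0.
have w1 : \sum_ii w ii = 1.
  rewrite -(pair_bigA _ (fun i i' => x i ^+ 2 * x i' ^+ 2)) /=.
  by under eq_bigr do rewrite -mulr_sumr x1 mulr1.
pose u (S : {ffun I -> {set D}}) (ii : I * I) : K :=
  if ii.2 != ii.1 then c * #|S ii.1 :&: S ii.2|%SET%:R else 0.
have prod_sum1 : \sum_(S : {ffun I -> {set D}}) \prod_l mu l (S l) = 1.
  by rewrite -(bigA_distr_bigA mu) /= big1.
have bound1 : 1 <= (1 + q * p ^+ 2) ^+ #|D|.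
  by rewrite exprn_ege1 // lerDl mulr_ge0 ?sqr_ge0.
apply: (@le_trans _ _ (\sum_ii w ii * \sum_(S : {ffun I -> {set D}})
    (\prod_l mu l (S l)) * expR (u S ii))); last first.
  rewrite -[leRHS]mul1r -[X in _ <= X * _]w1 mulr_suml; apply: ler_sum => -[i i'] _.
  apply: ler_wpM2l => //; rewrite /u /=; case: eqVneq => [_|ii'].
    by under eq_bigr do rewrite expR0 mulr1; rewrite prod_sum1.
  under eq_bigr => S _.
    have -> : expR (c * #|S i :&: S i'|%SET%:R) = (1 + q) ^+ #|S i :&: S i'|%SET.
      by rewrite mulrC expRM_natl /q subrKC.
    over.
  by apply: intersection_mgf => //; rewrite eq_sym.
under [leRHS]eq_bigr do rewrite mulr_sumr.
rewrite exchange_big /=; apply: ler_sum => S _.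
under [leRHS]eq_bigr do rewrite mulrCA.
rewrite -mulr_sumr; apply: ler_wpM2l; first exact: prodr_ge0.
apply: le_trans (expR_sum_le (u S) w0 w1).
rewrite ler_expR le_eqVlt; apply/orP; left; apply/eqP.
rewrite -(pair_bigA _ (fun i i' => w (i, i') * u S (i, i'))) /= mulr_sumr.
apply: eq_bigr => i _; rewrite mulr_sumr big_mkcond /=; apply: eq_bigr => i' _.
by rewrite /u /w /=; case: eqP => _ /=; [rewrite mulr0|ring].
Qed.
End pattern.

(** * Distortion of real row vectors under random signs and random supports *)

Section law.
Context (K : realType) (I D : finType) (alpha : nat) (r0 : D).
Implicit Types (S : {ffun I -> {set D}}) (sg : {ffun I * 'I_alpha -> bool})
  (x : I -> K).

(** A nonzero entry is indexed by its row and its rank from left to right, as in [nonzero_entries].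
    The default [r0] is never reached when each [S i] has [alpha] elements. *)
Definition position S (e : I * 'I_alpha) : D := nth r0 (enum (S e.1)) e.2.

Definition column_sum S x sg r :=
  \sum_(e | position S e == r) sgn K (sg e) * x e.1.

Definition column_mass S x r := \sum_(e | position S e == r) x e.1 ^+ 2.

(** When every [S i] has [alpha] elements, this is [alpha * (||xR||^2 - ||x||^2)] for the matrix [R]
    with entries [sg / sqrt alpha] on the support [S]. *)
Definition distortion S x sg :=
  \sum_r (column_sum S x sg r ^+ 2 - column_mass S x r).

Lemma sum_position S i r : #|S i| = alpha ->
  \sum_(k < alpha | position S (i, k) == r) 1 = (r \in S i)%:R :> K.
Proof.
move=> Sa; rewrite /position /=.
have -> : \sum_(k < alpha | nth r0 (enum (S i)) k == r) 1 =
          \sum_(j <- enum (S i) | j == r) 1 :> K.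
  by rewrite (big_nth r0) -cardE Sa big_mkord.
rewrite -big_filter (_ : [seq j <- _ | _] = if r \in S i then [:: r] else [::]).
  by case: (r \in S i); rewrite ?big_seq1 ?big_nil.
case: ifPn => rS.
  by rewrite filter_pred1_uniq ?enum_uniq // mem_enum.
apply/eqP; rewrite -[_ == _]negbK -has_filter; apply/hasPn => j.
by rewrite mem_enum; apply: contraL => /eqP ->.
Qed.

Lemma column_massE S x r : (forall i, #|S i| = alpha) ->
  column_mass S x r = \sum_(i | r \in S i) x i ^+ 2.
Proof.
move=> Sa; rewrite /column_mass [RHS]big_mkcond /=.
rewrite -(pair_big_dep xpredT (fun i k => position S (i, k) == r)
   (fun i k => x i ^+ 2)) /=.
apply: eq_bigr => i _.
rewrite (eq_bigr (fun=> x i ^+ 2 * 1)) => [|k _]; last by rewrite mulr1.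
by rewrite -mulr_sumr sum_position //; case: ifP; rewrite ?mulr1 ?mulr0.
Qed.

Lemma sum_column_mass S x : (forall i, #|S i| = alpha) ->
  \sum_r column_mass S x r = alpha%:R * \sum_i x i ^+ 2.
Proof.
move=> Sa; under eq_bigr do rewrite column_massE // big_mkcond.
rewrite exchange_big /= mulr_sumr; apply: eq_bigr => i _.
by rewrite -big_mkcond /= sumr_const Sa mulr_natl.
Qed.

(** Rewrites the exponent of [chaos_mgf] through pairwise overlaps: the diagonal terms
    [alpha * x_i^4] of the expanded squares are exactly the subtracted fourth powers. *)
Lemma sum_column_mass_sqr S x : (forall i, #|S i| = alpha) ->
  \sum_r column_mass S x r ^+ 2 - \sum_(e : I * 'I_alpha) x e.1 ^+ 4 =
  \sum_i \sum_(i' | i' != i) x i ^+ 2 * x i' ^+ 2 * #|S i :&: S i'|%SET%:R.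
Proof.
move=> Sa.
have -> : \sum_r column_mass S x r ^+ 2 =
    \sum_i \sum_i' x i ^+ 2 * x i' ^+ 2 * #|S i :&: S i'|%SET%:R.
  have sqE r : column_mass S x r ^+ 2 = \sum_i \sum_i'
      x i ^+ 2 * x i' ^+ 2 * (r \in S i :&: S i')%SET%:R.
    rewrite column_massE // expr2 big_mkcond mulr_suml; apply: eq_bigr => i _.
    rewrite mulr_sumr; apply: eq_bigr => i' _; rewrite inE.
    by do 2 case: (r \in _); rewrite ?mulr1 ?mulr0 ?mul0r.
  under eq_bigr do rewrite sqE.
  rewrite exchange_big; apply: eq_bigr => i _ /=.
  rewrite exchange_big; apply: eq_bigr => i' _ /=.
  rewrite -mulr_sumr -sum1_card natr_sum [in RHS]big_mkcond /=.
  by congr (_ * _); apply: eq_bigr => r _; case: (r \in _).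
rewrite -(pair_bigA _ (fun i k => x i ^+ 4)) /= -sumrB.
apply: eq_bigr => i _; rewrite (bigD1 i) //= finset.setIid Sa.
by rewrite sumr_const card_ord -mulr_natr; ring.
Qed.

Context (mu : I -> {set D} -> K) (p : K).
Hypothesis mu_ge0 : forall i B, 0 <= mu i B.
Hypothesis mu_sum1 : forall i, \sum_S mu i S = 1.
Hypothesis mu_superset : forall i (B : {set D}),
  \sum_S mu i S * (B \subset S)%:R <= p ^+ #|B|.
Hypothesis mu_card : forall i (B : {set D}), #|B| != alpha -> mu i B = 0.

Lemma distortion_mgf x (t : K) : `|t| <= 1 / 16 -> \sum_i x i ^+ 2 = 1 ->
  \sum_(S : {ffun I -> {set D}}) (\prod_l mu l (S l)) *
    \sum_sg expR (t * distortion S x sg) <=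
  #|{ffun I * 'I_alpha -> bool}|%:R *
    (1 + (expR (16 * t ^+ 2) - 1) * p ^+ 2) ^+ #|D|.
Proof.
move=> t16 x1; set N := #|_|%:R.
apply: (@le_trans _ _ (N * \sum_(S : {ffun I -> {set D}}) (\prod_l mu l (S l)) *
     expR (16 * t ^+ 2 * \sum_i \sum_(i' | i' != i)
        x i ^+ 2 * x i' ^+ 2 * #|S i :&: S i'|%SET%:R))); last first.
  apply: ler_wpM2l => //.
  by apply: pattern_mgf => //; rewrite mulr_ge0 ?sqr_ge0.
rewrite mulr_sumr; apply: ler_sum => S _; rewrite mulrCA.
have [/forallP Sa|] := boolP [forall i, #|S i| == alpha]; last first.
  (* Patterns with a row of the wrong size have weight 0. *)
  by case/forallPn => i Si; rewrite (bigD1 i) //= mu_card // !mul0r.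
have {}Sa i : #|S i| = alpha by exact/eqP.
apply: ler_wpM2l; first by apply: prodr_ge0.
have mass_le1 r : 0 <= column_mass S x r <= 1.
  rewrite column_massE // sumr_ge0 => [|i _]; last exact: sqr_ge0.
  rewrite -x1 big_mkcond /=; apply: ler_sum => i _.
  by case: ifP => // _; exact: sqr_ge0.
(* Column masses are at most 1, so with [tau = 2|t|] the hypothesis of [chaos_mgf] amounts to
   [16 |t| <= 1] at worst; the exponent then carries [4 tau^2 = 16 t^2]. *)
have tau0 : 0 <= 2 * `|t| by rewrite mulr_ge0.
have := @chaos_mgf K _ D (position S) (fun e => x e.1)
  (index_enum (I * 'I_alpha)%type) (2 * `|t|) (fun=> t) tau0 (index_enum_uniq _).
have -> : 4 * (2 * `|t|) ^+ 2 = 16 * t ^+ 2.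
  by rewrite exprMn real_normK ?num_real //; ring.
rewrite sum_column_mass_sqr //; under eq_bigr do rewrite -mulr_sumr; apply.
move=> r; rewrite [leRHS]mulrC; apply: ler_wpM2l => //.
have := mass_le1 r; rewrite /column_mass /colmass; move: (\sum_(_ | _) _) => m m01.
have : 0 <= `|t| by []. move: `|t| t16 => a a16 a0. nra.
Qed.

Lemma distortionZ S x sg (a : K) :
  distortion S (fun i => a * x i) sg = a ^+ 2 * distortion S x sg.
Proof.
rewrite /distortion mulr_sumr; apply: eq_bigr => r _.
rewrite mulrBr /column_mass mulr_sumr -exprMn /column_sum mulr_sumr.
congr (_ ^+ 2 - _); apply: eq_bigr => e _; first by rewrite mulrCA.
by rewrite exprMn.
Qed.

(** All rows share the same signs and supports. Since [distortion] is quadratic, the normalized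
    total is a convex combination, with weights [m l / F], of the distortions of unit rows, and
    Jensen's inequality applies. *)
Lemma family_distortion_mgf (L : finType) (x : L -> I -> K) (t : K) :
  `|t| <= 1 / 16 ->
  let F := \sum_l \sum_i x l i ^+ 2 in 0 < F ->
  \sum_(S : {ffun I -> {set D}}) (\prod_l mu l (S l)) *
    \sum_sg expR (t * ((\sum_l distortion S (x l) sg) / F)) <=
  #|{ffun I * 'I_alpha -> bool}|%:R *
    (1 + (expR (16 * t ^+ 2) - 1) * p ^+ 2) ^+ #|D|.
Proof.
move=> t16 F F0; set B := _ * (1 + _) ^+ _.
pose m l := \sum_i x l i ^+ 2.
have m0 l : 0 <= m l by apply: sumr_ge0 => i _; exact: sqr_ge0.
pose y l i := x l i / Num.sqrt (m l).
have xE l i : x l i = Num.sqrt (m l) * y l i.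
  (* A row of mass 0 vanishes identically, so the identity survives division by zero in [y]. *)
  have [ml|ml] := eqVneq (m l) 0; last first.
    by rewrite /y mulrC divfK // sqrtr_eq0 -ltNge lt_def ml m0.
  rewrite ml sqrtr0 mul0r; apply/eqP; rewrite -sqrf_eq0 eq_le sqr_ge0 andbT.
  rewrite -ml /m (bigD1 i) //= lerDl; apply: sumr_ge0 => j _; exact: sqr_ge0.
have dE S sg l : distortion S (x l) sg = m l * distortion S (y l) sg.
  rewrite (_ : x l = fun i => Num.sqrt (m l) * y l i); last first.
    by apply/funext => i; exact: xE.
  by rewrite distortionZ sqr_sqrtr.
pose w l := m l / F.
have w0 l : 0 <= w l by rewrite divr_ge0 // ltW.
have w1 : \sum_l w l = 1 by rewrite -mulr_suml divff // gt_eqF.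
have jensen S sg : expR (t * ((\sum_l distortion S (x l) sg) / F)) <=
    \sum_l w l * expR (t * distortion S (y l) sg).
  apply: le_trans (expR_sum_le _ w0 w1).
  rewrite ler_expR le_eqVlt; apply/orP; left; apply/eqP.
  rewrite mulr_suml mulr_sumr; apply: eq_bigr => l _.
  by rewrite dE /w; ring.
apply: (@le_trans _ _ (\sum_l w l * \sum_(S : {ffun I -> {set D}})
   (\prod_l mu l (S l)) * \sum_sg expR (t * distortion S (y l) sg))); last first.
  rewrite -[leRHS]mul1r -[X in _ <= X * _]w1 mulr_suml; apply: ler_sum => l _.
  have [wl|wl] := eqVneq (w l) 0; first by rewrite wl !mul0r.
  apply: ler_wpM2l => //; apply: distortion_mgf => //.
  have ml : m l != 0 by apply: contra wl => /eqP; rewrite /w => ->; rewrite mul0r.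
  under eq_bigr do rewrite /y expr_div_n sqr_sqrtr //.
  by rewrite -mulr_suml divff.
under [leRHS]eq_bigr do rewrite mulr_sumr.
rewrite exchange_big /=; apply: ler_sum => S _.
under [leRHS]eq_bigr do rewrite mulrCA.
rewrite -mulr_sumr; apply: ler_wpM2l; first exact: prodr_ge0.
under [leRHS]eq_bigr do rewrite mulr_sumr.
rewrite exchange_big /=; apply: ler_sum => sg _; exact: jensen.
Qed.

End law.

(** * Two-sided tail bound by Markov's inequality *)

Lemma expR_le_linear (K : realType) (x : K) : 0 <= x <= 1 / 2 ->
  expR x - 1 <= 2 * x.
Proof.
move=> /andP[x0 x2].
have h : expR x * (1 - x) <= 1.
  have := expR_ge1Dx (- x); rewrite expRN => h.
  have : expR x * (1 + - x) <= expR x * (expR x)^-1 by rewrite ler_pM2l ?expR_gt0.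
  by rewrite divff // gt_eqF // expR_gt0.
suff : expR x * (1 - x) <= (1 + 2 * x) * (1 - x) by rewrite ler_pM2r; lra.
apply: le_trans h _; nra.
Qed.

(** Here [n] is the number of columns. By [expR_le_linear] each column costs at most [32 t^2 alpha^2
    / n^2 = 32 eps^2 / 64^2 = eps^2 / 128] in the exponent. *)
Lemma mgf_base_le (K : realType) (n : nat) (alpha eps t : K) :
  0 < n%:R :> K -> 0 < alpha -> t ^+ 2 * alpha ^+ 2 = (eps * n%:R / 64) ^+ 2 ->
  t ^+ 2 <= 1 / 64 ^+ 2 ->
  (1 + (expR (16 * t ^+ 2) - 1) * (alpha / n%:R) ^+ 2) ^+ n <=
  expR (eps ^+ 2 * n%:R / 128).
Proof.
move=> n0 a0 ta t64; have t0 := sqr_ge0 t.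
have -> : eps ^+ 2 * n%:R / 128 = (eps ^+ 2 / 128) * n%:R by ring.
rewrite expRM_natr; apply: lerXn2r; rewrite ?nnegrE ?expR_ge0 //.
  rewrite addr_ge0 // mulr_ge0 ?sqr_ge0 // subr_ge0.
  by apply: le_trans (expR_ge1Dx _); rewrite lerDl mulr_ge0.
apply: le_trans (expR_ge1Dx _); rewrite lerD2l.
have hexp : expR (16 * t ^+ 2) - 1 <= 2 * (16 * t ^+ 2).
  by apply: expR_le_linear; apply/andP; split; lra.
apply: le_trans (ler_wpM2r (sqr_ge0 _) hexp) _.
have -> : 2 * (16 * t ^+ 2) * (alpha / n%:R) ^+ 2 =
  32 * (t ^+ 2 * alpha ^+ 2) / n%:R ^+ 2 by rewrite expr_div_n; ring.
by rewrite ta le_eqVlt; apply/orP; left; apply/eqP; field; rewrite gt_eqF.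
Qed.

Section tail.
Context (K : realType) (I D L : finType) (alpha : nat) (r0 : D).
Context (mu : I -> {set D} -> K) (x : L -> I -> K) (eps : K).
Hypothesis mu_ge0 : forall i B, 0 <= mu i B.
Hypothesis mu_sum1 : forall i, \sum_B mu i B = 1.
Hypothesis mu_superset : forall i (B : {set D}),
  \sum_T mu i T * (B \subset T)%:R <= (alpha%:R / #|D|%:R) ^+ #|B|.
Hypothesis mu_card : forall i (B : {set D}), #|B| != alpha -> mu i B = 0.
Hypothesis eps_gt0 : 0 < eps.
Hypothesis alpha_gt0 : (0 < alpha)%N.
Hypothesis alpha_ge : eps * #|D|%:R <= alpha%:R.

Lemma distortion_tail :
  let F := \sum_l \sum_i x l i ^+ 2 in 0 < F ->
  \sum_(S : {ffun I -> {set D}}) (\prod_l mu l (S l)) *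
    \sum_(sg : {ffun I * 'I_alpha -> bool})
      (eps * alpha%:R * F < `|\sum_l distortion r0 S (x l) sg|)%R%:R <=
  #|{ffun I * 'I_alpha -> bool}|%:R * (2 * expR (- (eps ^+ 2 * #|D|%:R / 128))).
Proof.
move=> F F0; set N := #|{ffun I * 'I_alpha -> bool}|%:R.
have D0 : 0 < #|D|%:R :> K by rewrite ltr0n; apply/card_gt0P; exists r0.
have a0 : 0 < alpha%:R :> K by rewrite ltr0n.
(* This [t] minimizes [- t * eps * alpha + 32 t^2 alpha^2 / |D|]. The bound [alpha >= eps * |D|]
   gives [t <= 1/64], within the range allowed for the exponential moment. *)
pose t : K := eps * #|D|%:R / 64 / alpha%:R.
have t0 : 0 < t by rewrite !divr_gt0 // mulr_gt0.
have t64 : t <= 1 / 64 by rewrite ler_pdivrMr //; move: alpha_ge; lra.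
have ta : t * alpha%:R = eps * #|D|%:R / 64 by rewrite divfK // gt_eqF.
have base : (1 + (expR (16 * t ^+ 2) - 1) * (alpha%:R / #|D|%:R) ^+ 2) ^+ #|D| <=
    expR (eps ^+ 2 * #|D|%:R / 128).
  apply: mgf_base_le => //; first by rewrite -exprMn ta.
  have -> : 1 / 64 ^+ 2 = (1 / 64) ^+ 2 :> K by rewrite expr_div_n expr1n.
  by rewrite ler_sqr ?nnegrE // ltW.
pose M (u : K) := \sum_(S : {ffun I -> {set D}}) (\prod_l mu l (S l)) *
    \sum_(sg : {ffun I * 'I_alpha -> bool})
       expR (u * ((\sum_l distortion r0 S (x l) sg) / F)).
have M_le u : u ^+ 2 = t ^+ 2 -> `|u| = t ->
    M u <= N * expR (eps ^+ 2 * #|D|%:R / 128).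
  move=> u2 ut; have := @family_distortion_mgf K I D alpha r0 mu
    (alpha%:R / #|D|%:R) mu_ge0 mu_sum1 mu_superset mu_card L x u.
  rewrite ut u2 => /(_ _ F0) h; apply: le_trans (h _) _; first lra.
  by apply: ler_wpM2l base; rewrite /N.
(* Markov's inequality gains [a], the exponential moment costs [a / 2], and [a / 2] remains. *)
set a := eps ^+ 2 * #|D|%:R / 64.
have taeps : t * (eps * alpha%:R) = a by rewrite mulrCA ta /a; ring.
apply: (@le_trans _ _ (expR (- a) * (M t + M (- t)))); last first.
  have h1 := M_le t erefl (gtr0_norm t0).
  have h2 : M (- t) <= N * expR (eps ^+ 2 * #|D|%:R / 128).
    by apply: M_le; rewrite ?sqrrN ?normrN ?gtr0_norm.
  have -> : - (eps ^+ 2 * #|D|%:R / 128) = - a + eps ^+ 2 * #|D|%:R / 128.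
    by rewrite /a; field.
  rewrite expRD.
  have -> : N * (2 * (expR (- a) * expR (eps ^+ 2 * #|D|%:R / 128))) =
    expR (- a) * (N * expR (eps ^+ 2 * #|D|%:R / 128) +
                  N * expR (eps ^+ 2 * #|D|%:R / 128)) by ring.
  by rewrite ler_pM2l ?expR_gt0 // lerD.
rewrite /M; clear M_le; clearbody F; rewrite -big_split /= mulr_sumr; apply: ler_sum => S _.
rewrite -mulrDr mulrCA; apply: ler_wpM2l; first exact: prodr_ge0.
rewrite -big_split /= mulr_sumr; apply: ler_sum => sg _.
set e := \sum_l _; rewrite mulrDr -!expRD.
have e1 := expR_ge0 (- a + t * (e / F)); have e2 := expR_ge0 (- a + - t * (e / F)).
case: ltP => [big|_]; last by rewrite addr_ge0.
(* On a large deviation, the exponential whose sign matches that of [e] already dominates the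
   indicator. *)
have one_le : 1 <= expR (- a + t * (`|e| / F)).
  rewrite -expR0 ler_expR addrC subr_ge0 -taeps; apply: ler_wpM2l; first exact: ltW.
  by rewrite ler_pdivlMr // ltW.
have [e0|e0] := ger0P e; move: one_le.
  by rewrite ger0_norm // => h; apply: le_trans h _; rewrite lerDl.
by rewrite ltr0_norm // mulNr mulrN -mulNr => h; apply: le_trans h _; rewrite lerDr.
Qed.

End tail.

(** * Probabilities of events determined by a finite-valued variable *)

Section finite_valued.
Context (K : realType) (disp : measure_display) (T : measurableType disp).
Variable P : probability T K.

Lemma measurable_forall_fin (F : finType) (A : F -> set T) :
  (forall x, measurable (A x)) -> measurable [set w | forall x, A x w].
Proof.
move=> mA; rewrite (_ : [set _ | _] = \bigcap_(x in [set: F]) A x).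
  by apply: fin_bigcap_measurable => [|x _]; [exact: finite_finset|exact: mA].
by apply/seteqP; split=> w /= h x; [move=> _; exact: h|exact: h].
Qed.

Lemma probability_bigcup_fin (F : finType) (Q : pred F) (A : F -> set T) :
  (forall x, Q x -> measurable (A x)) ->
  (forall x y w, Q x -> Q y -> A x w -> A y w -> x = y) ->
  P (\bigcup_(x in [set x | Q x]) A x) = (\sum_(x | Q x) P (A x))%E.
Proof.
move=> mA dA; rewrite measure_fin_bigcup //.
- by rewrite (bigfs _ (index_enum_uniq F)) // => x _; rewrite mem_index_enum.
- exact: finite_finset.
- by move=> x y /= Qx Qy [w [Aw Bw]]; exact: (dA _ _ w).
Qed.

Variables (F : finType) (f : T -> F).
Hypothesis mf : forall y, measurable [set w | f w = y].

Lemma fin_preimageE (Q : pred F) :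
  [set w | Q (f w)] = \bigcup_(y in [set y | Q y]) [set w | f w = y].
Proof.
by apply/seteqP; split=> w /=; [move=> Qw; exists (f w)|case=> y Qy fy; rewrite fy].
Qed.

Lemma measurable_fin_preimage (Q : pred F) : measurable [set w | Q (f w)].
Proof.
by rewrite fin_preimageE; apply: fin_bigcup_measurable => //; exact: finite_finset.
Qed.

Lemma probability_fin_preimage (Q : pred F) :
  P [set w | Q (f w)] = (\sum_(y | Q y) P [set w | f w = y])%E.
Proof.
rewrite fin_preimageE probability_bigcup_fin // => x y w _ _ /= -> //.
Qed.

End finite_valued.

(** * Counting for the graph and block constructions *)

(** The ratio of the two binomials is the product of [(alpha - j) / (d - j)] for [j < b], and each
    factor is at most [alpha / d]. *)
Lemma bin_sub_le (d alpha b : nat) : (alpha <= d)%N -> (b <= alpha)%N ->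
  ('C(d - b, alpha - b) * d ^ b <= 'C(d, alpha) * alpha ^ b)%N.
Proof.
move=> ad; elim: b => [|b IH] ba; first by rewrite !subn0 !expn0.
have {}IH := IH (ltnW ba).
have [n dn] : exists n, (d - b = n.+1)%N by exists (d - b).-1; lia.
have [m am] : exists m, (alpha - b = m.+1)%N by exists (alpha - b).-1; lia.
have -> : (d - b.+1 = n)%N by lia.
have -> : (alpha - b.+1 = m)%N by lia.
rewrite dn am in IH.
(* After multiplication by [n + 1] and the absorption identity, this is
   [(alpha - b) * d <= (d - b) * alpha]. *)
have step : ('C(n, m) * d <= 'C(n.+1, m.+1) * alpha)%N.
  have := mul_bin_diag n.+1 m; rewrite /= => diag.
  rewrite -(leq_pmul2l (ltn0Sn n)) mulnA diag.
  rewrite -mulnA mulnCA [leqRHS]mulnCA leq_mul2l; apply/orP; right.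
  have -> : n.+1 = (d - b)%N by lia.
  have -> : m.+1 = (alpha - b)%N by lia.
  nia.
rewrite !expnS !mulnA; apply: (@leq_trans ('C(n.+1, m.+1) * alpha * d ^ b)).
  by rewrite leq_mul2r step orbT.
by rewrite mulnAC [leqRHS]mulnAC leq_mul2r IH orbT.
Qed.

(** Union with [B] is a bijection from the [(alpha - |B|)]-subsets of the complement of [B]. *)
Lemma card_draws_superset (d alpha : nat) (B : {set 'I_d}) :
  #|[set S : {set 'I_d} | (B \subset S) && (#|S| == alpha)]%SET| =
  if (#|B| <= alpha)%N then 'C(d - #|B|, alpha - #|B|) else 0%N.
Proof.
case: leqP => Ba; last first.
  apply: eq_card0 => S; rewrite inE; apply/negP => /andP[BS /eqP Sa].
  by have := subset_leq_card BS; rewrite Sa leqNgt Ba.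
have <- : #|~: B|%SET = (d - #|B|)%N by rewrite cardsCs finset.setCK card_ord.
rewrite -cards_draws.
rewrite -[RHS](card_in_imset (f := fun A => (B :|: A)%SET)); last first.
  move=> A A'; rewrite !inE => /andP[AB _] /andP[AB' _] /(congr1 (fun X => X :\: B)%SET).
  rewrite !finset.setDUl finset.setDv !finset.set0U.
  by move: AB AB'; rewrite -!finset.disjoints_subset => /finset.setDidPl -> /finset.setDidPl ->.
congr #|pred_of_set _|; apply/setP => S; rewrite inE; apply/andP/imsetP.
  move=> [BS /eqP Sa]; exists (S :\: B)%SET; last first.
    by apply/setP => j; rewrite !inE; case: (boolP (j \in B)) => // /(fintype.subsetP BS) ->.
  rewrite inE finset.setDE finset.subsetIr /= -finset.setDE cardsD.
  by move/finset.setIidPr: BS => ->; rewrite Sa.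
move=> [A]; rewrite inE => /andP[AB /eqP Aa] ->; split; first exact: finset.subsetUl.
rewrite cardsU Aa finset.setIC.
move: AB; rewrite -finset.disjoints_subset => /finset.disjoint_setI0 ->.
by rewrite cards0 subn0 subnKC.
Qed.

Lemma card_chunk_ge (d alpha : nat) (c : 'I_alpha) : (0 < d %/ alpha)%N ->
  (alpha %| d)%N -> (d %/ alpha <= #|chunk d c|)%N.
Proof.
move=> q0 ad; set q := (d %/ alpha)%N.
have dE : d = (q * alpha)%N by rewrite /q divnK.
have lt_d (k : 'I_q) : (c * q + k < d)%N.
  by rewrite dE; have := ltn_ord c; have := ltn_ord k; nia.
pose g (k : 'I_q) := Ordinal (lt_d k).
have g_inj : injective g.
  by move=> k k' /(congr1 val) /= /addnI /val_inj.
rewrite -[leqLHS]card_ord -cardsT -(card_imset _ g_inj) subset_leq_card //.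
apply/fintype.subsetP => j /imsetP[k _ ->]; rewrite inE -/q /=.
by rewrite divnMDl // divn_small ?addn0.
Qed.

Lemma sum_card_chunk (d alpha : nat) (B : {set 'I_d}) : (0 < d %/ alpha)%N ->
  (alpha %| d)%N -> (\sum_(c < alpha) #|B :&: chunk d c|%SET = #|B|)%N.
Proof.
move=> q0 ad; have dE : d = (d %/ alpha * alpha)%N by rewrite divnK.
under eq_bigr do rewrite -sum1_card big_mkcond /=.
rewrite exchange_big -sum1_card [RHS]big_mkcond /=; apply: eq_bigr => j _.
have jc : (j %/ (d %/ alpha) < alpha)%N by rewrite ltn_divLR // mulnC -dE.
rewrite (bigD1 (Ordinal jc)) //= big1 => [|c cj]; last first.
  rewrite !inE; case: eqP => [jE|]; last by rewrite andbF.
  by case/eqP: cj; apply: val_inj.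
by rewrite addn0 !inE eqxx andbT.
Qed.

(** * Law of the support of a row and its superset probabilities *)

Section sjlt_law.
Context (K : realType) (n d : nat) (disp : measure_display)
  (T : measurableType disp) (P : probability T K) (alpha : nat)
  (R : T -> 'M[K]_(n, d)).
Hypothesis base : sjlt_base P alpha R.

Lemma measurable_entry i j (Y : set K) : measurable Y ->
  measurable [set w | Y (R w i j)].
Proof.
move=> mY; case: base => _ mR _ _.
by have := mR i j measurableT Y mY; rewrite setTI.
Qed.

(** Measurability is assumed of the entries; this event is a finite intersection of conditions that
    an entry is zero or nonzero. *)
Lemma measurable_nonzero_pos i (S : {set 'I_d}) :
  measurable [set w | nonzero_pos (R w) i = S].
Proof.
rewrite (_ : [set _ | _] = [set w | forall j, (R w i j != 0) = (j \in S)]).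
  apply: measurable_forall_fin => j.
  apply: (@measurable_entry i j [set c | (c != 0) = (j \in S)]).
  case: (j \in S).
    rewrite (_ : [set _ | _] = ~` [set 0]); first exact: measurableC.
    by apply/seteqP; split=> c /=; [move/eqP|move=> h; apply/eqP].
  rewrite (_ : [set _ | _] = [set 0]); first exact: measurable_set1.
  by apply/seteqP; split=> c /=; [move/negbFE/eqP|move=> ->; rewrite eqxx].
apply/seteqP; split=> w /= h; first by move=> j; rewrite -h inE.
by apply/setP => j; rewrite inE.
Qed.

Definition pattern_law i (S : {set 'I_d}) : K :=
  fine (P [set w | nonzero_pos (R w) i = S]).

Lemma pattern_lawE i S :
  P [set w | nonzero_pos (R w) i = S] = (pattern_law i S)%:E.
Proof. by rewrite fineK // fin_num_measure //; exact: measurable_nonzero_pos. Qed.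

Lemma pattern_law_ge0 i S : 0 <= pattern_law i S.
Proof. exact: fine_ge0. Qed.

Lemma sum_pattern_law i (Q : pred {set 'I_d}) :
  P [set w | Q (nonzero_pos (R w) i)] = (\sum_(S | Q S) pattern_law i S)%:E.
Proof.
rewrite (probability_fin_preimage P (@measurable_nonzero_pos i)) -sumEFin.
by apply: eq_bigr => S _; rewrite pattern_lawE.
Qed.

Lemma pattern_law_sum1 i : \sum_S pattern_law i S = 1.
Proof.
apply: EFin_inj; rewrite -(sum_pattern_law i xpredT) -(probability_setT P).
by congr (P _); apply/seteqP; split.
Qed.

(** Rows have [alpha] nonzero entries almost surely, so a support of another size is a negligible
    event. *)
Lemma pattern_law_card i (B : {set 'I_d}) : #|B| != alpha -> pattern_law i B = 0.
Proof.
move=> Ba; apply: EFin_inj; rewrite -pattern_lawE.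
apply: measure_negligible; first exact: measurable_nonzero_pos.
case: base => _ _ [N [mN N0 subN]] _; exists N; split => //.
apply: subset_trans subN => w /= posB /(_ i) cardB.
by case/eqP: Ba; rewrite -posB.
Qed.

Lemma sum_supersetE i (B : {set 'I_d}) :
  \sum_S pattern_law i S * (B \subset S)%:R =
  \sum_(S : {set 'I_d} | B \subset S) pattern_law i S.
Proof.
rewrite [RHS]big_mkcond; apply: eq_bigr => S _.
by case: ifP; rewrite ?mulr1 ?mulr0.
Qed.

Lemma graph_superset :
  (forall i, uniform_on P (enum [set S : {set 'I_d} | #|S| == alpha]%SET)
               (fun w => nonzero_pos (R w) i)) ->
  forall i (B : {set 'I_d}),
  \sum_S pattern_law i S * (B \subset S)%:R <= (alpha%:R / d%:R) ^+ #|B|.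
Proof.
move=> unif i B; case: base => /andP[a0 ad] _ _ _.
have lawE S : pattern_law i S = (#|S| == alpha)%:R / 'C(d, alpha)%:R.
  apply: EFin_inj; rewrite -pattern_lawE unif mem_enum inE -cardE.
  congr (_ / _%:R)%:E; rewrite -[in RHS](card_ord d) -cardsT -cards_draws.
  by apply: eq_card => S'; rewrite !inE finset.subsetT.
have C0 : 0 < 'C(d, alpha)%:R :> K by rewrite ltr0n bin_gt0.
have d0 : 0 < d%:R :> K by rewrite ltr0n (leq_trans a0).
under eq_bigr do rewrite lawE mulrAC -natrM mulnb andbC.
rewrite -mulr_suml -natr_sum.
rewrite (_ : (\sum_S _ = #|[set S : {set 'I_d} | (B \subset S) && (#|S| == alpha)]%SET|)%N);
  last first.
  rewrite -sum1_card [RHS]big_mkcond /=; apply: eq_bigr => S _.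
  by rewrite !inE; case: (_ && _).
rewrite card_draws_superset; case: leqP => Ba; last first.
  by rewrite mul0r exprn_ge0 // divr_ge0.
rewrite expr_div_n ler_pdivlMr ?exprn_gt0 // mulrAC ler_pdivrMr //.
by rewrite -!natrX -!natrM ler_nat [leqRHS]mulnC bin_sub_le.
Qed.

(** A chunk meets the support in one uniform position. It covers a trace of [B] with 0, 1 or more
    elements with probability 1, at most [alpha / d], or 0; each is at most [alpha / d] to the size
    of the trace, and these sizes add up to [|B|]. *)
Lemma block_superset : (alpha %| d)%N ->
  (forall i, mutually_independent P
          (fun (c : 'I_alpha) w => (nonzero_pos (R w) i :&: chunk d c)%SET) /\
        forall c : 'I_alpha,
          uniform_on P [seq [set j]%SET | j <- enum (chunk d c)]
            (fun w => (nonzero_pos (R w) i :&: chunk d c)%SET)) ->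
  forall i (B : {set 'I_d}),
  \sum_S pattern_law i S * (B \subset S)%:R <= (alpha%:R / d%:R) ^+ #|B|.
Proof.
move=> dvd blk i B; case: base => /andP[a0 ad] _ _ _.
case: (blk i) => indep unif.
have q0 : (0 < d %/ alpha)%N by rewrite divn_gt0.
have d0 : 0 < d%:R :> K by rewrite ltr0n (leq_trans a0).
have aq : alpha%:R / d%:R = (d %/ alpha)%:R^-1 :> K.
  rewrite -[X in _ / X%:R](divnK dvd) natrM invfM mulrCA divff ?mulr1 //.
  by rewrite pnatr_eq0 -lt0n.
pose nu (c : 'I_alpha) (Y : {set 'I_d}) : K :=
  (Y \in [seq [set j]%SET | j <- enum (chunk d c)])%:R / #|chunk d c|%:R.
have nuE c Y : P [set w | (nonzero_pos (R w) i :&: chunk d c)%SET = Y] = (nu c Y)%:E.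
  by rewrite unif size_map -cardE.
have mcell (c : 'I_alpha) Y : measurable [set w | (nonzero_pos (R w) i :&: chunk d c)%SET = Y].
  have := measurable_fin_preimage (@measurable_nonzero_pos i)
    (fun S => (S :&: chunk d c)%SET == Y).
  by congr measurable; apply/seteqP; split=> w /= /eqP.
pose g w : {ffun 'I_alpha -> {set 'I_d}} :=
  [ffun c => (nonzero_pos (R w) i :&: chunk d c)%SET].
have gE y : [set w | g w = y] =
    [set w | forall c, (nonzero_pos (R w) i :&: chunk d c)%SET = y c].
  apply/seteqP; split=> w /=; first by move=> <- c; rewrite ffunE.
  by move=> h; apply/ffunP => c; rewrite ffunE.
have mg y : measurable [set w | g w = y].
  by rewrite gE; apply: measurable_forall_fin => c; exact: mcell.
(* The law of the traces on all the chunks is a product, so the probability of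
   containing [B] factorizes over the chunks. *)
have g_law y : P [set w | g w = y] = (\prod_c nu c (y c))%:E.
  rewrite gE -prodEFin (eq_bigr _ (fun c _ => esym (nuE c (y c)))).
  have := indep [set: 'I_alpha]%SET y.
  rewrite [in X in _ = X -> _](eq_bigl xpredT) => [<-|c]; last by rewrite inE.
  by congr (P _); apply/seteqP; split=> w /= h c; [move=> _|]; apply: h => //; rewrite inE.
have -> : \sum_S pattern_law i S * (B \subset S)%:R =
    \prod_c \sum_(Y : {set 'I_d} | (B :&: chunk d c)%SET \subset Y) nu c Y.
  rewrite sum_supersetE; apply: EFin_inj.
  rewrite -(sum_pattern_law i (fun S => B \subset S)).
  rewrite bigA_distr_big_dep -sumEFin.
  pose Q (y : {ffun 'I_alpha -> {set 'I_d}}) :=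
    y \in family (fun c (Y : {set 'I_d}) => (B :&: chunk d c)%SET \subset Y).
  under eq_bigr do rewrite -g_law.
  rewrite -(probability_fin_preimage P mg Q); congr (P _).
  apply/seteqP; split=> w /=.
    by move=> BN; apply/familyP => c; rewrite ffunE; exact: finset.setSI.
  move=> /familyP h; apply/fintype.subsetP => j jB.
  have jc : (j %/ (d %/ alpha) < alpha)%N by rewrite ltn_divLR // mulnC divnK.
  have := h (Ordinal jc); rewrite ffunE => /fintype.subsetP/(_ j).
  by rewrite !inE jB eqxx /= andbT => /(_ isT).
rewrite aq -(sum_card_chunk B q0 dvd) expr_sum.
have nu_ge0 c Y : 0 <= nu c Y by rewrite divr_ge0.
apply: ler_prod => c _; rewrite sumr_ge0 //=; set X := (B :&: _)%SET.
have nu_card (Y : {set 'I_d}) : #|Y| != 1%N -> nu c Y = 0.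
  move=> Y1; rewrite /nu; case: mapP => [[j _ Yj]|_]; last by rewrite mul0r.
  by move: Y1; rewrite Yj cards1.
case: (ltngtP #|X| 1) => X1.
- move: X1; rewrite ltnS leqn0 cards_eq0 => /eqP ->.
  rewrite cards0 expr0 le_eqVlt; apply/orP; left; apply/eqP/EFin_inj.
  rewrite -sumEFin; under eq_bigr do rewrite -nuE.
  rewrite -(probability_fin_preimage P (mcell c)) -(probability_setT P).
  by congr (P _); apply/seteqP; split=> w //= _; exact: finset.sub0set.
- rewrite big1 ?exprn_ge0 ?invr_ge0 // => Y /subset_leq_card XY.
  by apply: nu_card; rewrite gtn_eqF // (leq_trans X1).
have /cards1P[j Xj] : #|X| == 1%N by rewrite X1.
rewrite X1 Xj (bigD1 [set j]%SET) //= big1 ?addr0 => [|Y /andP[jY Yj]]; last first.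
  apply: nu_card; apply: contra Yj => /cards1P[k Yk].
  by move: jY; rewrite Yk finset.sub1set inE => /eqP ->.
have c0 : 0 < #|chunk d c|%:R :> K by rewrite ltr0n (leq_trans q0) // card_chunk_ge.
apply: (@le_trans _ _ (#|chunk d c|%:R^-1)).
  by rewrite /nu; case: (_ \in _); rewrite ?mul1r ?mul0r ?invr_ge0.
by rewrite lef_pV2 ?posrE ?ler_nat ?ltr0n ?card_chunk_ge // -(ltr0n K).
Qed.

End sjlt_law.

(** * Reduction of complex matrices to real rows *)

Section frobenius.
Context (K : realType) (m n : nat) (A : 'M[K[i]]_(m, n)).

(** Since [R] is real, it acts separately on real and imaginary parts, so [A] can be treated as [2m]
    real rows. *)
Definition real_row (l : 'I_m * bool) (i : 'I_n) : K :=
  if l.2 then complex.Re (A l.1 i) else complex.Im (A l.1 i).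

Lemma normc_sqr (z : K[i]) :
  ComplexField.Normc.normc z ^+ 2 = complex.Re z ^+ 2 + complex.Im z ^+ 2.
Proof. by case: z => x y /=; rewrite sqr_sqrtr // addr_ge0 ?sqr_ge0. Qed.

Lemma frob_mul_sqr d (M : 'M[K]_(n, d)) :
  frob (A *m complex_mx M) ^+ 2 =
  \sum_l \sum_r (\sum_i real_row l i * M i r) ^+ 2.
Proof.
rewrite sqr_sqrtr; last first.
  by do 2 (apply: sumr_ge0 => ? _); exact: sqr_ge0.
rewrite -(pair_bigA _ (fun a b => \sum_r (\sum_i real_row (a, b) i * M i r) ^+ 2)) /=.
apply: eq_bigr => a _; rewrite big_bool -big_split /=; apply: eq_bigr => r _.
rewrite normc_sqr; congr (_ ^+ 2 + _ ^+ 2).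
  rewrite mxE raddf_sum /=; apply: eq_bigr => i _.
  by rewrite !mxE /real_row /=; case: (A a i) => x y /=; rewrite mulr0 subr0.
rewrite mxE raddf_sum /=; apply: eq_bigr => i _.
by rewrite !mxE /real_row /=; case: (A a i) => x y /=; rewrite mulr0 add0r.
Qed.

Lemma frob_sqr : frob A ^+ 2 = \sum_l \sum_i real_row l i ^+ 2.
Proof.
rewrite sqr_sqrtr; last first.
  by do 2 (apply: sumr_ge0 => ? _); exact: sqr_ge0.
rewrite -(pair_bigA _ (fun a b => \sum_i real_row (a, b) i ^+ 2)) /=.
apply: eq_bigr => a _; rewrite big_bool -big_split /=; apply: eq_bigr => i _.
exact: normc_sqr.
Qed.

End frobenius.

(** * Decomposition of the probability space by signs and supports *)

Section atoms.
Context (K : realType) (n d : nat) (disp : measure_display)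
  (T : measurableType disp) (P : probability T K) (alpha : nat)
  (R : T -> 'M[K]_(n, d)) (r0 : 'I_d).
Implicit Types (sg : {ffun 'I_n * 'I_alpha -> bool})
  (S : {ffun 'I_n -> {set 'I_d}}).

Definition sign_mx sg : 'M[K]_(n, alpha) :=
  \matrix_(i, k) (sgn K (sg (i, k)) * (1 / Num.sqrt alpha%:R)).

(** When all supports have size [alpha], the whole matrix is determined on this event, so
    probabilities about [R] become finite sums. *)
Definition atom sg S : set T :=
  [set w | nonzero_entries alpha (R w) = sign_mx sg /\
           [ffun i => nonzero_pos (R w) i] = S].

Lemma nonzero_entriesE (M : 'M[K]_(n, d)) S i k :
  (forall i, nonzero_pos M i = S i) -> (forall i, #|S i| = alpha) ->
  nonzero_entries alpha M i k = M i (position r0 S (i, k)).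
Proof.
move=> posM Sa; rewrite mxE /position /=.
have -> : [seq j <- enum 'I_d | M i j != 0] = enum (S i).
  rewrite enumT [RHS]/enum_mem; apply: eq_filter => j.
  by transitivity (j \in S i); [rewrite -posM inE|].
by rewrite (nth_map r0) // -cardE Sa.
Qed.

Lemma atom_nonzero_pos sg S w : atom sg S w ->
  forall i, nonzero_pos (R w) i = S i.
Proof. by case=> _ <- i; rewrite ffunE. Qed.

Lemma atom_entry sg S w i r : (forall i, #|S i| = alpha) -> atom sg S w ->
  R w i r = 1 / Num.sqrt alpha%:R *
            \sum_(k < alpha | position r0 S (i, k) == r) sgn K (sg (i, k)).
Proof.
move=> Sa at_w; have posS := atom_nonzero_pos at_w.
case: at_w => entS _.
(* The entry vanishes off the support; on it, [sum_position] turns the indicator into a sum over the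
   unique rank [k] at position [r]. *)
transitivity (R w i r * (r \in S i)%:R).
  rewrite -posS inE; case: eqVneq => [->|_]; by rewrite ?mul0r ?mulr1.
rewrite -(sum_position K r0 r (Sa i)) !mulr_sumr; apply: eq_bigr => k /eqP posr.
rewrite mulr1 -posr -nonzero_entriesE // entS mxE mulrC //.
Qed.

Hypothesis base : sjlt_base P alpha R.

(** The places of the listed nonzero entries depend on [w], but once the supports are fixed to [S]
    they are the deterministic [position r0 S]. *)
Lemma measurable_atom sg S : (forall i, #|S i| = alpha) ->
  measurable (atom sg S).
Proof.
move=> Sa; rewrite (_ : atom sg S =
    [set w | forall i, nonzero_pos (R w) i = S i] `&`
    [set w | forall ik : 'I_n * 'I_alpha,
       R w ik.1 (position r0 S ik) = sign_mx sg ik.1 ik.2]).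
  apply: measurableI; apply: measurable_forall_fin => i.
    exact: (measurable_nonzero_pos base).
  exact: (measurable_entry base i.1 (position r0 S i) (measurable_set1 _)).
apply/seteqP; split=> w.
  move=> at_w; have posS := atom_nonzero_pos at_w; split=> // -[i k] /=.
  by case: at_w => <- _; rewrite (nonzero_entriesE _ _ posS).
move=> [/= posS ent]; split; last by apply/ffunP => i; rewrite ffunE.
by apply/matrixP => i k; rewrite (nonzero_entriesE _ _ posS) // (ent (i, k)).
Qed.

(** Signs are independent of the supports and each has probability 1/2, so every sign pattern has
    the same probability; supports of different rows multiply. *)
Lemma probability_atom sg S : P (atom sg S) =
  (#|{ffun 'I_n * 'I_alpha -> bool}|%:R^-1 * \prod_i pattern_law P R i (S i))%:E.
Proof.
case: base => _ _ _ [ind_ent unif indep ind_pos].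
rewrite indep EFinM; congr (_ * _)%E.
  have -> : [set w | nonzero_entries alpha (R w) = sign_mx sg] =
     [set w | forall ik, ik \in [set: 'I_n * 'I_alpha]%SET ->
        nonzero_entries alpha (R w) ik.1 ik.2 = sign_mx sg ik.1 ik.2].
    apply/seteqP; split=> w /= h; first by rewrite h.
    by apply/matrixP => i k; apply: (h (i, k)); rewrite inE.
  rewrite (ind_ent _ (fun ik => sign_mx sg ik.1 ik.2)).
  rewrite (eq_bigl xpredT) => [|ik]; last by rewrite inE.
  rewrite (eq_bigr (fun=> (2^-1)%:E)) => [|ik _]; last first.
    rewrite (unif ik.1 ik.2) mxE /sgn !inE /=.
    by case: (sg _); rewrite ?mul1r ?mulN1r eqxx ?orbT mul1r.
  by rewrite prodEFin prodr_const card_ffun card_bool natrX exprVn.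
have -> : [set w | [ffun i => nonzero_pos (R w) i] = S] =
   [set w | forall i, i \in [set: 'I_n]%SET -> nonzero_pos (R w) i = S i].
  apply/seteqP; split=> w /= h; first by move=> i _; rewrite -h ffunE.
  by apply/ffunP => i; rewrite ffunE h ?inE.
rewrite ind_pos -prodEFin; apply: eq_big => [i|i _]; first by rewrite inE.
exact: (pattern_lawE base).
Qed.

Lemma sum_distortion_atom m (A : 'M[K[i]]_(m, n)) sg S w :
  (forall i, #|S i| = alpha) -> atom sg S w ->
  \sum_l distortion r0 S (real_row A l) sg =
  alpha%:R * (frob (A *m complex_mx (R w)) ^+ 2 - frob A ^+ 2).
Proof.
move=> Sa at_w; case: base => /andP[a0 _] _ _ _.
have rowE l r : \sum_i real_row A l i * R w i r =
    1 / Num.sqrt alpha%:R * column_sum r0 S (real_row A l) sg r.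
  rewrite /column_sum mulr_sumr.
  under eq_bigr do rewrite (atom_entry _ _ Sa at_w) mulrCA mulr_sumr mulr_sumr.
  rewrite (pair_big_dep xpredT (fun i k => position r0 S (i, k) == r)
   (fun i k => 1 / Num.sqrt alpha%:R * (real_row A l i * sgn K (sg (i, k))))) /=.
  by apply: eq_big => [[i k]|[i k] _] //=; rewrite [real_row _ _ _ * _]mulrC.
have a2 : (1 / Num.sqrt alpha%:R) ^+ 2 = alpha%:R^-1 :> K.
  by rewrite expr_div_n expr1n sqr_sqrtr // div1r.
rewrite frob_mul_sqr frob_sqr -sumrB mulr_sumr; apply: eq_bigr => l _.
rewrite mulrBr -(sum_column_mass r0 _ Sa) /distortion sumrB; congr (_ - _).
rewrite mulr_sumr; apply: eq_bigr => r _; rewrite rowE exprMn a2 mulrA divff ?mul1r //.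
by rewrite pnatr_eq0 -lt0n.
Qed.

Lemma measurable_frob_event m (A : 'M[K[i]]_(m, n)) (lo hi : K) :
  measurable [set w | lo <= frob (A *m complex_mx (R w)) ^+ 2 <= hi].
Proof.
case: base => _ mR _ _.
have mf : measurable_fun setT (fun w => frob (A *m complex_mx (R w)) ^+ 2).
  rewrite (_ : (fun _ => _) = fun w =>
     \sum_l \sum_r (\sum_i real_row A l i * R w i r) ^+ 2); last first.
    by apply/funext => w; exact: frob_mul_sqr.
  apply: measurable_sum => l; apply: measurable_sum => r; apply: measurable_funX.
  by apply: measurable_sum => i; apply: measurable_funM => //; exact: mR.
have := mf measurableT `[lo, hi]%classic (measurable_itv _); rewrite setTI.
by congr measurable; apply/seteqP; split=> w /=; rewrite in_itv.
Qed.

(** The good atoms are disjoint and contained in [E], so their total mass bounds [P E] from below,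
    and the missing mass is that of the bad pairs. *)
Lemma atoms_probability_ge (bad : {ffun 'I_n * 'I_alpha -> bool} ->
    {ffun 'I_n -> {set 'I_d}} -> bool) (delta : K) (E : set T) :
  measurable E ->
  (forall sg S w, (forall i, #|S i| = alpha) -> atom sg S w -> ~~ bad sg S -> E w) ->
  \sum_(S : {ffun 'I_n -> {set 'I_d}}) (\prod_i pattern_law P R i (S i)) * \sum_sg (bad sg S)%:R <=
    #|{ffun 'I_n * 'I_alpha -> bool}|%:R * delta ->
  ((1 - delta)%:E <= P E)%E.
Proof.
move=> mE goodE; set N : K := #|_|%:R => bad_le.
have N0 : 0 < N by rewrite ltr0n card_ffun card_bool expn_gt0.
pose Q (x : {ffun 'I_n * 'I_alpha -> bool} * {ffun 'I_n -> {set 'I_d}}) :=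
  [forall i, #|x.2 i| == alpha] && ~~ bad x.1 x.2.
have mA x : Q x -> measurable (atom x.1 x.2).
  by move=> /andP[/forallP Sa _]; apply: measurable_atom => i; exact/eqP.
have sgn_inj : injective (sgn K).
  by move=> [] [] //=; rewrite /sgn => h; exfalso; move: h; lra.
case: (base) => /andP[a0 _] _ _ _.
have sq0 : 1 / Num.sqrt alpha%:R != 0 :> K.
  by rewrite div1r invr_eq0 sqrtr_eq0 -ltNge ltr0n.
have disj x y w : Q x -> Q y -> atom x.1 x.2 w -> atom y.1 y.2 w -> x = y.
  case: x y => sg S [sg' S'] /= _ _ [entx posx] [enty posy].
  rewrite -posx -posy; congr (_, _); apply/ffunP => -[i k].
  have := congr1 (fun M : 'M[K]_(n, alpha) => M i k) (etrans (esym entx) enty).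
  by rewrite !mxE => /(mulIf sq0)/sgn_inj.
apply: (@le_trans _ _ (P (\bigcup_(x in [set x | Q x]) atom x.1 x.2))); last first.
  apply: le_measure; rewrite ?inE //.
    by apply: fin_bigcup_measurable; [exact: finite_finset|move=> x /mA].
  move=> w [[sg S] /= /andP[/forallP Sa nb] at_w]; apply: goodE at_w nb => i.
  exact/eqP.
rewrite (probability_bigcup_fin P mA disj).
under eq_bigr do rewrite probability_atom.
rewrite sumEFin lee_fin.
(* The total runs over all pairs; those with a support of the wrong size have weight 0, so removing
   them loses no mass. *)
have total : \sum_(x : {ffun 'I_n * 'I_alpha -> bool} * {ffun 'I_n -> {set 'I_d}})
    N^-1 * \prod_i pattern_law P R i (x.2 i) = 1.
  rewrite -mulr_sumr -(pair_bigA _ (fun sg S => \prod_i pattern_law P R i (S i))) /=.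
  rewrite -(bigA_distr_bigA (pattern_law P R)) /= sumr_const -/N.
  rewrite big1 => [|i _]; last exact: (pattern_law_sum1 base).
  by rewrite mulVf // gt_eqF.
rewrite lerBlDr -[X in X <= _]total -lerBlDl [X in _ - X]big_mkcond -sumrB /=.
rewrite -ler_pdivrMl // in bad_le; apply: le_trans bad_le.
rewrite mulr_sumr; under [leRHS]eq_bigr do rewrite mulr_sumr mulr_sumr.
rewrite exchange_big /= pair_bigA /=.
apply: ler_sum => -[sg S] _ /=; rewrite mulrA.
rewrite /Q /=; have [_|/forallPn[i Si]] := boolP [forall i, #|S i| == alpha].
  by case: (bad sg S); rewrite /= ?subr0 ?subrr ?mulr1 ?mulr0.
have -> : \prod_i pattern_law P R i (S i) = 0.
  by rewrite (bigD1 i) //= (pattern_law_card base) ?mul0r.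
by rewrite mulr0 mul0r subrr.
Qed.

End atoms.

(** * Choice of the constant and conclusion *)

Theorem theorem3 (K : realType) :
  exists C : K, 0 < C /\
    forall (m n d alpha : nat) (A : 'M[K[i]]_(m, n)) (eps delta : K)
      (disp : measure_display) (T : measurableType disp)
      (P : probability T K) (R : T -> 'M[K]_(n, d)),
      0 < eps < 1 ->
      0 < delta < 1 / 2 ->
      graph_sjlt P alpha R \/ block_sjlt P alpha R ->
      C * eps ^- 2 * ln (1 / delta) <= d%:R ->
      alpha%:Z = Num.ceil (eps * d%:R) ->
      ((1 - delta)%:E <=
        P [set w | ((1 - eps) * frob A ^+ 2 <= frob (A *m complex_mx (R w)) ^+ 2
                    <= (1 + eps) * frob A ^+ 2)%R])%E.
Proof.
(* With 256, [eps^2 d / 128 >= 2 ln (1 / delta)], so the tail is at most [2 delta^2], which is at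
   most [delta] since [delta < 1/2]. *)
exists 256; split => // m n d alpha A eps delta disp T P R /andP[e0 e1]
  /andP[d0 d1] sjlt dC alphaE.
have base : sjlt_base P alpha R by case: sjlt => [[]|[]].
have [/andP[a0 ad] _ _ _] := base.
have dpos : (0 < d)%N by apply: leq_trans ad.
pose r0 : 'I_d := Ordinal dpos.
have superset i (B : {set 'I_d}) :
    \sum_S pattern_law P R i S * (B \subset S)%:R <=
    (alpha%:R / #|'I_d|%:R) ^+ #|B|.
  rewrite card_ord; case: sjlt => [[_ unif]|[_ dvd blk]].
    exact: (graph_superset base).
  exact: (block_superset base).
have mE := measurable_frob_event base A ((1 - eps) * frob A ^+ 2) ((1 + eps) * frob A ^+ 2).
have alpha_ge : eps * #|'I_d|%:R <= alpha%:R.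
  rewrite card_ord; apply: le_trans (Num.Theory.ceil_ge _) _.
  by rewrite -alphaE.
(* The tail bound normalizes by the squared norm, so [A = 0] is treated apart; both sides are then 0
   for every [w]. *)
have [F0|F0] := eqVneq (frob A ^+ 2) 0.
  have rows0 l i : real_row A l i = 0.
    apply/eqP; rewrite -sqrf_eq0 eq_le sqr_ge0 andbT -F0 frob_sqr.
    rewrite (bigD1 l) //= (bigD1 i) //= -addrA lerDl addr_ge0 //.
      by apply: sumr_ge0 => ? _; exact: sqr_ge0.
    by do 2 (apply: sumr_ge0 => ? _); exact: sqr_ge0.
  rewrite (_ : [set _ | _] = setT).
    by rewrite probability_setT lee_fin; lra.
  apply/seteqP; split=> w //= _; rewrite F0 !mulr0 frob_mul_sqr.
  rewrite big1 ?lexx // => l _; rewrite big1 // => r _.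
  by rewrite big1 ?expr0n // => i _; rewrite rows0 mul0r.
have {}F0 : 0 < frob A ^+ 2 by rewrite lt_def F0 sqr_ge0.
apply: (atoms_probability_ge r0 base (bad := fun sg S =>
   eps * alpha%:R * frob A ^+ 2 < `|\sum_l distortion r0 S (real_row A l) sg|)) => //.
  move=> sg S w Sa at_w; rewrite -leNgt (sum_distortion_atom r0 base _ Sa at_w).
  have ap : 0 < alpha%:R :> K by rewrite ltr0n.
  rewrite normrM gtr0_norm // [eps * _]mulrC -mulrA ler_pM2l // ler_norml.
  by move=> /andP[h1 h2]; apply/andP; split; lra.
have := distortion_tail r0 (pattern_law_ge0 P R) (pattern_law_sum1 base)
  superset (pattern_law_card base) e0 a0 alpha_ge (x := real_row A).
rewrite -frob_sqr => /(_ F0) tail; apply: le_trans tail _.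
apply: ler_wpM2l => //; rewrite card_ord.
have ln0 : ln (1 / delta) = - ln delta by rewrite div1r lnV // posrE.
have two : 2 * delta ^+ 2 <= delta by nra.
have deltaE : delta = expR (ln delta) by rewrite lnK ?posrE.
have logd : 256 * - ln delta <= eps ^+ 2 * d%:R.
  have e2 : 0 < eps ^+ 2 by rewrite exprn_gt0.
  have := ler_wpM2l (ltW e2) dC; rewrite ln0; congr (_ <= _).
  by field; rewrite gt_eqF.
apply: le_trans two; rewrite ler_pM2l // [in leRHS]deltaE -expRM_natr ler_expR.
lra.
Qed.
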